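(* Let $F$ be an RS-fan. For $J\subseteq J_1\subseteq J_2\subseteq I$ in $\mathrm{Spec}(F)$ and $h\in S^I_J$ set $$B^{J_1,J_2}(h)=\{g\in S^{J_2}_{J_1}: g\rightsquigarrow h\},\qquad A^{J_1,J_2}(h)=\{g\in C^{J_2}_{J_1}: g\rightsquigarrow h\}.$$ Then: (a) For $h_1,h_2\in S^I_J$ we have $\mathrm{card}(B^{J_1,J_2}(h_1))=\mathrm{card}(B^{J_1,J_2}(h_2))$. (b) For $h_1,h_2\in C^I_J$ we have $\mathrm{card}(A^{J_1,J_2}(h_1))=\mathrm{card}(A^{J_1,J_2}(h_2))$.
   Context: A ternary semigroup (TS) is a commutative monoid $(T,\cdot,1)$ with distinguished elements $0,-1$ such that, for all $x$: $x^3=x$; $x\cdot 0=0$; $-1\neq 1$ and $(-1)(-1)=1$; and $x=-x$ implies $x=0$ (where $-x:=(-1)\cdot x$). $\mathbf 3=\{1,0,-1\}$ with the usual multiplication is a TS. A real semigroup (RS) is a TS $G$ with a ternary relation ''$a\in D(b,c)$'' such that, writing $a\in D^t(b,c)$ for [$a\in D(b,c)$ and $-b\in D(-a,c)$ and $-c\in D(b,-a)$], for all $a,b,c,d,e\in G$: (RS0) $c\in D(a,b)\Leftrightarrow c\in D(b,a)$; (RS1) $a\in D(a,b)$; (RS2) $a\in D(b,c)\Rightarrow ad\in D(bd,cd)$; (RS3) $a\in D^t(b,c)$ and $c\in D^t(d,e)$ imply there is $x\in D^t(b,d)$ with $a\in D^t(x,e)$; (RS4) $e\in D(c^2a,d^2b)\Rightarrow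 e\in D(a,b)$; (RS5) $ad=bd$, $ae=be$, $c\in D(d,e)\Rightarrow ac=bc$; (RS6) $c\in D(a,b)\Rightarrow c\in D^t(c^2a,c^2b)$; (RS7) $D^t(a,-b)\cap D^t(b,-a)\neq\emptyset\Rightarrow a=b$; (RS8) $a\in D(b,c)\Rightarrow a^2\in D(b^2,c^2)$. Characters: $X_G$ is the set of maps $h:G\to\mathbf 3$ preserving product, $1,0,-1$, and such that $c\in D(a,b)$ implies $h(c)\in\{0,h(a),h(b)\}$. (Known duality: $c\in D(a,b)$ iff $h(c)\in\{0,h(a),h(b)\}$ for all $h\in X_G$, and $X_G$ separates points of $G$.) Products of characters are pointwise; $Z(h):=h^{-1}[0]$. Specialization: $g\rightsquigarrow h$ iff $h^{-1}[1]\subseteq g^{-1}[1]$ (equivalently $h^2=hg$). An RS-fan is an RS $F$ such that $X_F$ is closed under products of any three of its elements. An ideal of $F$ is a nonempty $I\subseteq F$ with $F\cdot I\subseteq I$; $\mathrm{Spec}(F)$ is the set of proper ideals. Known facts for an RS-fan $F$: every TS-homomorphism $F\to\mathbf 3$ lies in $X_F$; proper ideals are prime and saturated, and are totally ordered by inclusion; each is $Z(f)$ for some $f\in X_F$; for $g\in X_F$ and a proper ideal $I\supseteq Z(g)$ there is a unique $f\in X_F$ with $g\rightsquigarrow f$ and $Z(f)=I$. For $I\in\mathrm{Spec}(F)$, $L_I=\{h\in X_F: Z(h)=I\}$. For $J\subseteq I$ in $\mathrm{Spec}(F)$: $$S^I_J=\{h\in L_I:\exists g\in X_F\,(g\rightsquigarrow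 h\text{ and }Z(g)=J)\},$$ $$C^I_J=\{h\in S^I_J:\forall g'\in X_F\,(g'\rightsquigarrow h\Rightarrow J\subseteq Z(g'))\}.$$ *)

(* Defs.v *)
From HB Require Import structures.
From mathcomp Require Import all_boot all_classical.

Set Implicit Arguments.
Unset Strict Implicit.
Unset Printing Implicit Defensive.

Local Open Scope group_scope.
Local Open Scope classical_set_scope.

(* MathComp monoids carry a choiceType structure; since boolp provides one on
   every type, this does not restrict the carriers under consideration. *)
HB.mixin Record isTernarySemigroup T of Monoid T := {
  ts0 : T;
  tsN1 : T;
  ts_mulC : commutative (@mul T);
  ts_cube : forall x : T, x ^+ 3 = x;
  ts_mul0 : forall x : T, x * ts0 = ts0;
  ts_N1_neq1 : tsN1 <> 1;
  ts_mulN1N1 : tsN1 * tsN1 = 1;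
  ts_eqN_eq0 : forall x : T, x = tsN1 * x -> x = ts0
}.

#[short(type="ternarySemigroupType")]
HB.structure Definition TernarySemigroup :=
  {T of isTernarySemigroup T & Monoid T}.

Arguments ts0 {s}.
Arguments tsN1 {s}.

Definition tsopp (T : ternarySemigroupType) (x : T) : T := tsN1 * x.

Declare Scope ts_scope.
Delimit Scope ts_scope with TS.
Notation "- x" := (tsopp x) : ts_scope.
Local Open Scope ts_scope.

(* A ternary relation "a \in D(b, c)" is encoded as a set-valued binary
   operation D, so that membership reads [D b c a]; below, [rep] is D and
   [trans_rep rep] is D^t. *)
Definition trans_rep (T : ternarySemigroupType) (D : T -> T -> set T)
    (b c : T) : set T :=
  [set a | [/\ D b c a, D (- a) c (- b) & D b (- a) (- c)]].

HB.mixin Record isRealSemigroup G of TernarySemigroup G := {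
  rep : G -> G -> set G;
  rs0 : forall a b c : G, rep a b c <-> rep b a c;
  rs1 : forall a b : G, rep a b a;
  rs2 : forall a b c d : G, rep b c a -> rep (b * d) (c * d) (a * d);
  rs3 : forall a b c d e : G,
    trans_rep rep b c a -> trans_rep rep d e c ->
    exists x, trans_rep rep b d x /\ trans_rep rep x e a;
  rs4 : forall a b c d e : G,
    rep (c ^+ 2 * a) (d ^+ 2 * b) e -> rep a b e;
  rs5 : forall a b c d e : G,
    a * d = b * d -> a * e = b * e -> rep d e c -> a * c = b * c;
  rs6 : forall a b c : G,
    rep a b c -> trans_rep rep (c ^+ 2 * a) (c ^+ 2 * b) c;
  rs7 : forall a b : G,
    trans_rep rep a (- b) `&` trans_rep rep b (- a) !=set0 -> a = b;
  rs8 : forall a b c : G, rep b c a -> rep (b ^+ 2) (c ^+ 2) (a ^+ 2)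
}.

#[short(type="realSemigroupType")]
HB.structure Definition RealSemigroup :=
  {G of isRealSemigroup G & TernarySemigroup G}.

Variant three := Three1 | Three0 | ThreeN1.

Definition three_code (x : three) : option bool :=
  match x with Three1 => Some true | Three0 => None | ThreeN1 => Some false end.
Definition three_decode (o : option bool) : three :=
  match o with Some true => Three1 | None => Three0 | Some false => ThreeN1 end.

Lemma three_codeK : cancel three_code three_decode. Proof. by case. Qed.

HB.instance Definition _ := Choice.copy three (can_type three_codeK).

Definition three_mul (x y : three) : three :=
  match x, y with
  | Three0, _ | _, Three0 => Three0
  | Three1, Three1 | ThreeN1, ThreeN1 => Three1
  | _, _ => ThreeN1
  end.

Lemma three_mulA : associative three_mul. Proof. by do 3!case. Qed.
Lemma three_mul1x : left_id Three1 three_mul. Proof. by case. Qed.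
Lemma three_mulx1 : right_id Three1 three_mul. Proof. by case. Qed.

HB.instance Definition _ :=
  isMonoid.Build three three_mulA three_mul1x three_mulx1.

Lemma three_mulC : commutative (@mul three). Proof. by do 2!case. Qed.
Lemma three_cube (x : three) : x ^+ 3 = x. Proof. by case: x. Qed.
Lemma three_mul0 (x : three) : x * Three0 = Three0. Proof. by case: x. Qed.
Lemma three_N1_neq1 : ThreeN1 <> 1. Proof. by []. Qed.
Lemma three_mulN1N1 : ThreeN1 * ThreeN1 = 1 :> three. Proof. by []. Qed.
Lemma three_eqN_eq0 (x : three) : x = ThreeN1 * x -> x = Three0.
Proof. by case: x. Qed.

HB.instance Definition _ := isTernarySemigroup.Build three
  three_mulC three_cube three_mul0 three_N1_neq1 three_mulN1N1 three_eqN_eq0.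

Section RealSemigroupCharacters.
Variable G : realSemigroupType.
Implicit Types (f g h : G -> three) (I J : set G).

Definition characters : set (G -> three) :=
  [set h | [/\ {morph h : x y / x * y}, h 1 = 1, h ts0 = ts0, h tsN1 = tsN1
    & forall a b c : G, rep a b c -> h c \in [:: ts0; h a; h b]]].

Definition zero_set h : set G := h @^-1` [set ts0].

Definition specializes g h : Prop :=
  h @^-1` [set 1] `<=` g @^-1` [set 1].

Definition rs_fan : Prop :=
  forall f g h, characters f -> characters g -> characters h ->
    characters (fun x => f x * g x * h x).

Definition is_ideal I : Prop :=
  I !=set0 /\ forall x y : G, I y -> I (x * y).

Definition Spec : set (set G) := [set I | is_ideal I /\ I <> setT].

Definition level I : set (G -> three) :=
  [set h | characters h /\ zero_set h = I].

Definition level_S I J : set (G -> three) :=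
  [set h | level I h /\
    exists g, [/\ characters g, specializes g h & zero_set g = J]].

Definition level_C I J : set (G -> three) :=
  [set h | level_S I J h /\
    forall g, characters g -> specializes g h -> J `<=` zero_set g].

Definition B_set J1 J2 h : set (G -> three) :=
  [set g | level_S J2 J1 g /\ specializes g h].

Definition A_set J1 J2 h : set (G -> three) :=
  [set g | level_C J2 J1 g /\ specializes g h].

End RealSemigroupCharacters.

Arguments rs_fan G : clear implicits.
Arguments Spec G : clear implicits.

(* Main.v *)
Require Import Defs.
From HB Require Import structures.
From mathcomp Require Import all_boot all_classical.

Local Open Scope classical_set_scope.
Local Open Scope card_scope.

(** Given [h1, h2] in [S^I_J], choose characters [u ~> h1] and [v ~> h2] with
    [Z(u) = Z(v) = J]. Multiplication by [u * v] preserves zero sets containing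
    [J] and specialization, and it is involutive on the characters whose zero
    set contains [J]. Since [h1 * u * v = h2], it exchanges the characters
    specializing to [h1] with those specializing to [h2]; the fan axiom says
    that it preserves characters. For (b), if [h2] is in [C^I_J] then every [k]
    specializing to [h2] has [J] contained in [Z(k)], so that multiplying [k] by
    [u * v] keeps its zero set, and minimality transfers as well. *)

(** The maps need to be mutually inverse only on [A] and [B]: [twist u v] is in general not
    injective on all functions, since it kills values where [u] or [v] vanishes. *)
Lemma eq_bij_card (T U : Type) (A : set T) (B : set U)
    (f : T -> U) (g : U -> T) :
    (forall x, A x -> B (f x)) -> (forall y, B y -> A (g y)) ->
    (forall x, A x -> g (f x) = x) -> (forall y, B y -> f (g y) = y) ->
  A #= B.
Proof.
move=> AB BA fK gK; have -> : B = f @` A.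
  by apply/seteqP; split=> [y By|_ [x Ax <-]]; [exists (g y); auto | auto].
apply/card_esym/inj_card_eq => x y /set_mem Ax /set_mem Ay fxy.
by rewrite -(fK x) // fxy fK.
Qed.

Section Twist.
Context {F : realSemigroupType}.
Implicit Types (f g h u v : F -> three) (I J : set F).

(** Where [h x] is -1, the inclusion of the preimages of 1 is applied to [- x]. *)
Lemma specializesP g h : characters g -> characters h ->
  specializes g h <-> forall x, h x <> ts0 -> g x = h x.
Proof.
move=> [gM _ _ gN _] [hM h1 _ hN _]; split=> [gh x|gh x /= hx].
  have := gh x; have := gh (tsN1 * x)%g.
  rewrite /= hM gM hN gN; case: (h x) => //= ghN gh1 _; first exact: gh1.
  by have := ghN erefl; case: (g x).
by rewrite gh hx.
Qed.

Definition twist u v g : F -> three := fun x => (g x * u x * v x)%g.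

Lemma zero_set_twist u v g :
  zero_set u `<=` zero_set g -> zero_set v `<=` zero_set g ->
  zero_set (twist u v g) = zero_set g.
Proof.
move=> ug vg; apply/seteqP; split=> x; rewrite /zero_set /twist /=; last first.
  by move->.
move: (ug x) (vg x); rewrite /zero_set /=.
by case: (g x); case: (u x); case: (v x) => // a b _; auto.
Qed.

(** Where [g x] is nonzero, so are [u x] and [v x], and their squares are 1; elsewhere both sides
    vanish. *)
Lemma twistK u v g :
  zero_set u `<=` zero_set g -> zero_set v `<=` zero_set g ->
  twist v u (twist u v g) = g.
Proof.
move=> ug vg; apply/funext => x; rewrite /twist.
move: (ug x) (vg x); rewrite /zero_set /=.
by case: (g x); case: (u x); case: (v x) => // a b; rewrite ?(a erefl) ?(b erefl).
Qed.

(** Off [I], [u] agrees with [h1] and [v] with [h2], so the product is [h1 x ^+ 2 * h2 x = h2 x]; on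
    [I] both sides vanish. *)
Lemma twist_level u v h1 h2 I :
    characters u -> characters v -> specializes u h1 -> specializes v h2 ->
    level I h1 -> level I h2 ->
  twist u v h1 = h2.
Proof.
move=> Xu Xv uh1 vh2 [X1 Z1] [X2 Z2]; apply/funext => x; rewrite /twist.
have [h1x|h1x] := pselect (zero_set h1 x).
  have : zero_set h2 x by rewrite Z2 -Z1.
  by move: h1x; rewrite /zero_set /= => -> ->.
have h2x : ~ zero_set h2 x by rewrite Z2 -Z1.
rewrite ((specializesP _ _ Xu X1).1 uh1 x h1x).
rewrite ((specializesP _ _ Xv X2).1 vh2 x h2x).
by move: h1x; rewrite /zero_set /=; case: (h1 x); case: (h2 x).
Qed.

Hypothesis fanF : rs_fan F.

Lemma twist_specializes u v g h :
    characters u -> characters v -> characters g -> characters h ->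
  specializes g h -> specializes (twist u v g) (twist u v h).
Proof.
move=> Xu Xv Xg Xh /(specializesP _ _ Xg Xh) gh.
apply/specializesP; try exact: fanF.
by move=> x hx; rewrite /twist gh// => h0; apply: hx; rewrite /twist h0.
Qed.

Lemma specializes_trans f g h :
  specializes f g -> specializes g h -> specializes f h.
Proof. by move=> fg gh x /gh /fg. Qed.

Section Transport.
Context {J J1 J2 I : set F} {u v h1 h2 : F -> three}.
Hypotheses (JJ1 : J `<=` J1) (J1J2 : J1 `<=` J2).
Hypotheses (uJ : level J u) (vJ : level J v).
Hypotheses (uh1 : specializes u h1) (vh2 : specializes v h2).
Hypotheses (Ih1 : level I h1) (Ih2 : level I h2).

Let Xu : characters u := uJ.1.
Let Xv : characters v := vJ.1.

Lemma level_twist K g : J `<=` K -> level K g -> level K (twist u v g).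
Proof.
move=> JK [Xg Zg]; split; first exact: fanF.
by rewrite zero_set_twist ?Zg ?uJ.2 ?vJ.2.
Qed.

Lemma twist_twist g : J `<=` zero_set g -> twist v u (twist u v g) = g.
Proof. by move=> Jg; rewrite twistK ?uJ.2 ?vJ.2. Qed.

Lemma B_set_twist g : B_set J1 J2 h1 g -> B_set J1 J2 h2 (twist u v g).
Proof.
move=> [[lg [k [Xk kg Zk]]] gh1]; split; last first.
  rewrite -(twist_level _ _ _ _ _ Xu Xv uh1 vh2 Ih1 Ih2).
  exact: twist_specializes Xu Xv lg.1 Ih1.1 gh1.
split; first by apply: level_twist => //; exact: subset_trans J1J2.
(* The witness for [g] is twisted along with it; its zero set stays [J1] because [J1] contains
   [J]. *)
have [Xk' Zk'] : level J1 (twist u v k) by exact: level_twist.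
by exists (twist u v k); split=> //; exact: twist_specializes Xu Xv Xk lg.1 kg.
Qed.

Lemma A_set_twist g : level_C I J h2 ->
  A_set J1 J2 h1 g -> A_set J1 J2 h2 (twist u v g).
Proof.
move=> [_ minh2] [[Sg ming] gh1].
have [Sg' gh2] := B_set_twist g (conj Sg gh1).
split=> //; split=> // k Xk kg'.
have Jk : J `<=` zero_set k by apply: minh2 => //; exact: specializes_trans gh2.
have Xg' := Sg'.1.1.
(* Minimality of [g] is applied to [twist v u k], which has the zero set of [k] and specializes to
   [twist v u (twist u v g) = g]. *)
rewrite -(zero_set_twist v u) ?uJ.2 ?vJ.2//; apply: ming; first exact: fanF.
rewrite -(twist_twist g); first exact: twist_specializes Xv Xu Xk Xg' kg'.
by rewrite Sg.1.2; exact: subset_trans J1J2.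
Qed.

End Transport.
End Twist.

Theorem proposition2p10 (F : realSemigroupType) (fanF : rs_fan F)
    (J J1 J2 I : set F)
    (specJ : Spec F J) (specJ1 : Spec F J1) (specJ2 : Spec F J2)
    (specI : Spec F I)
    (JJ1 : J `<=` J1) (J1J2 : J1 `<=` J2) (J2I : J2 `<=` I) :
  (forall h1 h2 : F -> three, level_S I J h1 -> level_S I J h2 ->
     B_set J1 J2 h1 #= B_set J1 J2 h2) /\
  (forall h1 h2 : F -> three, level_C I J h1 -> level_C I J h2 ->
     A_set J1 J2 h1 #= A_set J1 J2 h2).
Proof.
have JJ2 : J `<=` J2 by exact: subset_trans J1J2.
split=> h1 h2.
- move=> [Ih1 [u [Xu uh1 Zu]]] [Ih2 [v [Xv vh2 Zv]]].
  have [uJ vJ] : level J u /\ level J v by [].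
  (* Writing the inverse as [twist v u] makes the backward direction the same lemma with [u], [v]
     and [h1], [h2] exchanged. *)
  apply: (eq_bij_card _ _ _ _ (twist u v) (twist v u)) => g.
  + exact: (B_set_twist fanF JJ1 J1J2 uJ vJ uh1 vh2 Ih1 Ih2).
  + exact: (B_set_twist fanF JJ1 J1J2 vJ uJ vh2 uh1 Ih2 Ih1).
  + by move=> [[[_ Zg] _] _]; apply: (twist_twist uJ vJ); rewrite Zg.
  + by move=> [[[_ Zg] _] _]; apply: (twist_twist vJ uJ); rewrite Zg.
- move=> Ch1 Ch2.
  have [[Ih1 [u [Xu uh1 Zu]]] _] := Ch1.
  have [[Ih2 [v [Xv vh2 Zv]]] _] := Ch2.
  have [uJ vJ] : level J u /\ level J v by [].
  apply: (eq_bij_card _ _ _ _ (twist u v) (twist v u)) => g.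
  (* Each direction uses the minimality of its target: [Ch2] here, [Ch1] for the inverse. *)
  + exact: (A_set_twist fanF JJ1 J1J2 uJ vJ uh1 vh2 Ih1 Ih2).
  + exact: (A_set_twist fanF JJ1 J1J2 vJ uJ vh2 uh1 Ih2 Ih1).
  + by move=> [[[[_ Zg] _] _] _]; apply: (twist_twist uJ vJ); rewrite Zg.
  + by move=> [[[[_ Zg] _] _] _]; apply: (twist_twist vJ uJ); rewrite Zg.
Qed.
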